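(* Let $ABC$ be any triangle in the Euclidean plane with area $A_{\Delta ABC}$, and let $a,b,c$ be its three side lengths listed in any order (any of the $3!=6$ orderings). Let $m_c$ be the length of the median to the side of length $c$. Then $$\left(\left(\frac{a}{2}\right)^2-\left(\frac{b}{2}\right)^2\right)^2+\left(A_{\Delta ABC}\right)^2=\left(\frac{c}{2}\,m_c\right)^2 .$$
   Context: The median to a side is the segment joining the midpoint of that side to the opposite vertex; its length for the side $c$ is $m_c=\frac12\sqrt{2a^2+2b^2-c^2}$. *)

(* Defs.v *)
From HB Require Import structures.
From mathcomp Require Import all_boot all_order all_algebra all_fingroup.
From mathcomp Require Import all_classical all_reals all_analysis.
Import Order.TTheory GRing.Theory Num.Theory.
Import numFieldNormedType.Exports.

Set Implicit Arguments.
Unset Strict Implicit.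
Unset Printing Implicit Defensive.

Local Open Scope classical_set_scope.
Local Open Scope ring_scope.

Notation plane R := (R * R)%type.

(* The library norm on [R * R] is the max norm, hence the explicit formula. *)
Definition dist (R : realType) (P Q : plane R) : R :=
  Num.sqrt ((P.1 - Q.1) ^+ 2 + (P.2 - Q.2) ^+ 2).

Definition midpoint (R : realType) (P Q : plane R) : plane R :=
  2^-1 *: (P + Q).

Definition collinear (R : realType) (V : 'I_3 -> plane R) : Prop :=
  exists P u : plane R,
    u != 0 /\ forall i : 'I_3, exists t : R, V i = P + t *: u.

Definition is_triangle (R : realType) (V : 'I_3 -> plane R) : Prop :=
  ~ collinear V.

(* The convex hull of the three vertices. *)
Definition triangle_region (R : realType) (V : 'I_3 -> plane R) :
    set (plane R) :=
  [set P | exists w : 'I_3 -> R,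
     [/\ forall i, 0 <= w i, \sum_(i < 3) w i = 1
       & P = \sum_(i < 3) w i *: V i]].

(* Two-dimensional Lebesgue measure of the region; the region is compact, so
   its measure is finite and [fine] loses nothing. *)
Definition area (R : realType) (V : 'I_3 -> plane R) : R :=
  fine ((@lebesgue_measure R \x @lebesgue_measure R)%E (triangle_region V)).

(* Side [i] is the one opposite to vertex [i]: as arithmetic in ['I_3] is
   modulo 3, its endpoints are the vertices [i + 1] and [i + 2]. *)
Definition side_length (R : realType) (V : 'I_3 -> plane R) (i : 'I_3) : R :=
  dist (V (i + 1)) (V (i + 2%:R)).

Definition median_length (R : realType) (V : 'I_3 -> plane R) (i : 'I_3) : R :=
  dist (midpoint (V (i + 1)) (V (i + 2%:R))) (V i).

(* Main.v *)
Require Import Defs.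
From HB Require Import structures.
From mathcomp Require Import all_boot all_order all_algebra all_fingroup.
From mathcomp Require Import all_classical all_reals all_analysis.
From mathcomp Require Import measurable_realfun ring lra.
Import Order.TTheory GRing.Theory Num.Theory.
Import numFieldNormedType.Exports.
Local Open Scope classical_set_scope.
Local Open Scope ring_scope.

(* The median identity is polynomial in the coordinates once the area is known
   to be half the absolute value of the cross product of two edge vectors.  For
   the area, let the outer vertices have distinct abscissae and trade the
   ordinate y for the barycentric coordinate t of the middle vertex: on each
   vertical line this is an affine map, with slope independent of the line.
   In the (x, t)-plane every horizontal slice of the triangle is an interval of
   length (1 - t) times the base, so Tonelli's theorem gives the measure. *)

(** * Scaling and integration on the line *)

Lemma lebesgue_measure_affine_preimage {R : realType} (k l : R) (A : set R) :
  k != 0 -> measurable A ->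
  lebesgue_measure ((fun y : R => ((y - l) / k)%R) @^-1` A) =
    (`|k|%:E * lebesgue_measure A)%E.
Proof.
move=> k0 mA.
have mf : measurable_fun [set: measurableTypeR R]
    ((fun y => (y - l) / k) : _ -> measurableTypeR R).
  by apply: measurable_funM => //; apply: measurable_funB.
(* The rescaled pushforward [m] agrees with Lebesgue measure on half-open intervals, hence
   everywhere by uniqueness. *)
have [m mE] : exists m : {measure set (measurableTypeR R) -> \bar R},
    forall B, m B = (`|k|^-1%:E *
      lebesgue_measure ((fun y : R => ((y - l) / k)%R) @^-1` B))%E.
  have ki_ge0 : 0 <= `|k|^-1 by rewrite invr_ge0.
  unshelve eexists (mscale (NngNum ki_ge0) (pushforward lebesgue_measure
    ((fun y => (y - l) / k) : _ -> measurableTypeR R))) => //.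
have -> : lebesgue_measure A = m A.
  apply: lebesgue_measure_unique mA.
  move=> _ [[a b] _ <-] /=.
  rewrite mE.
  (* A negative [k] reverses the interval and moves its closed end to the left; the length is
     unaffected. *)
  have -> : (fun y : R => (y - l) / k) @^-1` `]a, b] =
      [set` if 0 < k then `]a * k + l, b * k + l] else `[b * k + l, a * k + l[].
    apply/seteqP; split=> y; rewrite /= !in_itv/=;
    case: (ltP 0 k) => k1; rewrite ?in_itv/=.
    + by rewrite ltr_pdivlMr// ler_pdivrMr// ltrBrDr lerBlDr.
    + have k2 : k < 0 by rewrite lt_neqAle k0.
      by rewrite ltr_ndivlMr// ler_ndivrMr// ltrBlDr lerBrDr andbC.
    + by rewrite ltr_pdivlMr// ler_pdivrMr// ltrBrDr lerBlDr.
    + have k2 : k < 0 by rewrite lt_neqAle k0.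
      by rewrite ltr_ndivlMr// ler_ndivrMr// ltrBlDr lerBrDr andbC.
  rewrite !lebesgue_measure_itv/=.
  case: (ltP 0 k) => k1 /=; rewrite !lte_fin.
    rewrite ltrD2r ltr_pM2r//; case: ifP => _; last by rewrite mule0.
    rewrite -!EFinD -EFinM gtr0_norm//; congr (_%:E); field.
    by [].
  have k2 : k < 0 by rewrite lt_neqAle k0.
  rewrite ltrD2r ltr_nM2r//; case: ifP => _; last by rewrite mule0.
  rewrite -!EFinD -EFinM ltr0_norm//; congr (_%:E); field.
  by [].
by rewrite mE muleA -EFinM divff ?normr_eq0// mul1e.
Qed.

Lemma integral_onem_itv01 {R : realType} (d : R) :
  (\int[lebesgue_measure]_(t in `[0%R, 1%R]) (d * (1 - t))%:E = (d / 2)%:E)%E.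
Proof.
pose F (t : R) := d * (t - t ^+ 2 / 2).
have dF (x : R) : is_derive x 1 F (d * (1 - x)).
  rewrite /F; apply: is_derive_eq.
  by rewrite /GRing.scale/=; field.
have cF : continuous F.
  by move=> x; apply/differentiable_continuous/derivable1_diffP; have [] := dF x.
rewrite (@continuous_FTC2 _ _ F) //.
- by rewrite /F -EFinD; congr (_%:E); field.
- apply: continuous_subspaceT => x.
  apply: cvgM; first exact: cvg_cst.
  apply: cvgB; [exact: cvg_cst|exact: cvg_id].
- split.
  + by move=> x _; have [] := dF x.
  + apply: cvg_at_right_filter; exact: cF.
  + apply: cvg_at_left_filter; exact: cF.
- by move=> x _; rewrite derive1E; have [_ ->] := dF x.
Qed.

(** * Measure of a triangle with given vertices *)

Definition hull3 {R : realType} (P Q S : plane R) : set (plane R) :=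
  [set X | exists w : R * R * R,
    [/\ [/\ 0 <= w.1.1, 0 <= w.1.2 & 0 <= w.2], w.1.1 + w.1.2 + w.2 = 1,
        X.1 = w.1.1 * P.1 + w.1.2 * Q.1 + w.2 * S.1 &
        X.2 = w.1.1 * P.2 + w.1.2 * Q.2 + w.2 * S.2]].

(* Opposite in sign to the usual determinant of (Q - P, S - P). *)
Definition cross3 {R : realType} (P Q S : plane R) : R :=
  (Q.2 - P.2) * (S.1 - P.1) - (S.2 - P.2) * (Q.1 - P.1).

(** Together with the reversal below, this lets any two vertices be made the outer ones. *)
Lemma hull3_swap {R : realType} (P Q S : plane R) : hull3 Q P S = hull3 P Q S.
Proof.
by apply/seteqP; split=> X [[[a b] c] /= [[a0 b0 c0] abc X1 X2]];
  exists (b, a, c) => /=; split => //; lra.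
Qed.

Lemma hull3_rev {R : realType} (P Q S : plane R) : hull3 S Q P = hull3 P Q S.
Proof.
by apply/seteqP; split=> X [[[a b] c] /= [[a0 b0 c0] abc X1 X2]];
  exists (c, b, a) => /=; split => //; lra.
Qed.

(* The triangle in coordinates (abscissa, barycentric coordinate of the vertex
   with abscissa [x1]). *)
Definition barycentric_triangle {R : realType} (x0 x1 x2 : R) : set (plane R) :=
  [set X | [&& 0 <= X.2, x0 + X.2 * (x1 - x0) <= X.1
             & X.1 <= x2 - X.2 * (x2 - x1)]].

Lemma measurable_barycentric_triangle {R : realType} (x0 x1 x2 : R) :
  measurable (barycentric_triangle x0 x1 x2 :
    set (measurableTypeR R * measurableTypeR R)).
Proof.
rewrite -[X in measurable X]setTI.
have m1 : measurable_fun [set: measurableTypeR R * measurableTypeR R]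
  (fst : _ -> measurableTypeR R) by exact: measurable_fst.
have m2 : measurable_fun [set: measurableTypeR R * measurableTypeR R]
  (snd : _ -> measurableTypeR R) by exact: measurable_snd.
have mb : measurable_fun [set: measurableTypeR R * measurableTypeR R]
  (fun X : measurableTypeR R * measurableTypeR R =>
     [&& 0 <= X.2, x0 + X.2 * (x1 - x0) <= X.1 & X.1 <= x2 - X.2 * (x2 - x1)]).
  apply: measurable_and; first exact: measurable_fun_ler.
  apply: measurable_and; apply: measurable_fun_ler => //.
    by apply: measurable_funD => //; apply: measurable_funM.
  by apply: measurable_funB => //; apply: measurable_funM.
by apply: (mb measurableT [set true]).
Qed.

Lemma lebesgue_measure_barycentric_triangle {R : realType} (x0 x1 x2 : R) :
  x0 < x2 ->
  ((@lebesgue_measure R \x @lebesgue_measure R)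
     (barycentric_triangle x0 x1 x2) = ((x2 - x0) / 2)%:E)%E.
Proof.
move=> x02; set T := barycentric_triangle _ _ _.
have mT : measurable (T : set (measurableTypeR R * measurableTypeR R)).
  exact: measurable_barycentric_triangle.
(* Uniqueness of the product measure exchanges the order of integration, so that slices at fixed [t]
   are measured. *)
transitivity ((@lebesgue_measure R \x^ @lebesgue_measure R)%E T).
  apply: product_measure_unique => // A B mA mB; exact: product_measure2E.
rewrite -integral_onem_itv01 /product_measure2 [RHS]integral_mkcond.
apply: eq_integral => t _; rewrite /= patchE.
have -> : ysection T t = [set` if 0 <= t then
    `[x0 + t * (x1 - x0), x2 - t * (x2 - x1)] else `]0, 0[ : interval R].
  apply/seteqP; split=> x; rewrite /ysection/= in_setE /T/barycentric_triangle/=;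
    case: ifP => t0; rewrite !in_itv/=.
  - by [].
  - by [].
  - by [].
  - by case: ltgtP.
rewrite lebesgue_measure_itv mem_setE in_itv/=.
case: (leP 0 t) => t0 /=; last by rewrite ltxx.
(* Right end minus left end is [(x2 - x0) * (1 - t)]: the slice is a point at [t = 1] and empty
   beyond. *)
rewrite lte_fin; case: (leP t 1) => t1.
  case: ltP => xt; first by rewrite -EFinD; congr (_%:E); ring.
  by congr (_%:E); nra.
by case: ltP => // xt; exfalso; nra.
Qed.

(** On the vertical line through [X], [l] is the ordinate of the line [PS]; [k] is the signed
    vertical distance from that line to [Q]. Hence [(X.2 - l) / k] is the weight of [Q]. *)
Lemma hull3_affine_preimage {R : realType} (P Q S X : plane R)
    (d := S.1 - P.1) (k := cross3 P Q S / d)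
    (l := P.2 + (S.2 - P.2) / d * (X.1 - P.1)) :
  P.1 < S.1 -> cross3 P Q S != 0 ->
  hull3 P Q S X <->
  barycentric_triangle P.1 Q.1 S.1 (X.1, (X.2 - l) / k).
Proof.
move=> PS D0; have d0 : 0 < d by rewrite subr_gt0.
rewrite /barycentric_triangle /=; set t := (_ / k).
have dn0 : S.1 - P.1 != 0 by rewrite gt_eqF.
split=> [[[[a b] c] /= [[a0 b0 c0] abc X1 X2]]|/and3P[t0 tl tr]].
  have aE : a = 1 - b - c by lra.
  have -> : t = b.
    rewrite /t /k /l X1 X2 aE /d /cross3; field.
    by rewrite dn0 D0.
  by apply/and3P; split => //; rewrite X1 aE; nra.
(* Given [t], the weights [c] and [a] are forced by the abscissa and the total weight 1; [tl] and
   [tr] say that they are nonnegative. *)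
pose c := (X.1 - P.1 - t * (Q.1 - P.1)) / d.
pose a := (S.1 - X.1 - t * (S.1 - Q.1)) / d.
exists (a, t, c); split => /=.
- split=> //; apply: divr_ge0; rewrite ?(ltW d0)//; lra.
- by rewrite /a /c /d; field.
- by rewrite /a /c /d; field.
- have -> : X.2 = l + t * k.
    by rewrite /t divfK ?subrKC// mulf_neq0// invr_neq0.
  by rewrite /a /c /l /k /d /cross3; field.
Qed.

Lemma lebesgue_measure_hull3_lt {R : realType} (P Q S : plane R) :
  P.1 < S.1 -> cross3 P Q S != 0 ->
  ((@lebesgue_measure R \x @lebesgue_measure R) (hull3 P Q S) =
   (`|cross3 P Q S| / 2)%:E)%E.
Proof.
move=> PS D0; have d0 : 0 < S.1 - P.1 by rewrite subr_gt0.
set k := cross3 P Q S / (S.1 - P.1).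
have k0 : k != 0 by rewrite mulf_neq0// invr_eq0 gt_eqF.
pose T : set (measurableTypeR R * measurableTypeR R) :=
  barycentric_triangle P.1 Q.1 S.1.
have mT : measurable T by exact: measurable_barycentric_triangle.
(* The offset of the affine map varies with [x] but [k] does not, so [|k|] leaves the integral over
   vertical sections. *)
transitivity (`|k|%:E * (@lebesgue_measure R \x @lebesgue_measure R) T)%E.
  rewrite /product_measure1 -ge0_integralZl//; last first.
    exact: measurable_fun_xsection.
  apply: eq_integral => x _ /=.
  rewrite -(@lebesgue_measure_affine_preimage _ k
    (P.2 + (S.2 - P.2) / (S.1 - P.1) * (x - P.1)))//; last first.
    exact: measurable_xsection.
  congr lebesgue_measure; apply/seteqP.
  by split=> y; rewrite /xsection /= !in_setE => /(hull3_affine_preimage P Q S (x, y) PS D0).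
rewrite lebesgue_measure_barycentric_triangle// -EFinM; congr (_%:E).
rewrite /k normrM normfV (gtr0_norm d0); field.
by rewrite gt_eqF.
Qed.

Lemma lebesgue_measure_hull3 {R : realType} (P Q S : plane R) :
  cross3 P Q S != 0 ->
  ((@lebesgue_measure R \x @lebesgue_measure R) (hull3 P Q S) =
   (`|cross3 P Q S| / 2)%:E)%E.
Proof.
have swapE P' Q' : cross3 Q' P' S = - cross3 P' Q' S by rewrite /cross3; ring.
have revE P' Q' S' : cross3 S' Q' P' = - cross3 P' Q' S' by rewrite /cross3; ring.
move=> D0; case: (ltgtP P.1 S.1) => PS; first exact: lebesgue_measure_hull3_lt.
  rewrite -hull3_rev -normrN -revE; apply: lebesgue_measure_hull3_lt => //.
  by rewrite revE oppr_eq0.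
(* Now [P] and [S] share an abscissa, so [Q] replaces [P] as an outer vertex; three equal abscissae
   would make [cross3] vanish. *)
case: (ltgtP Q.1 S.1) => QS.
- rewrite -hull3_swap -normrN -swapE; apply: lebesgue_measure_hull3_lt => //.
  by rewrite swapE oppr_eq0.
- rewrite -hull3_swap -hull3_rev -normrN -swapE -normrN -revE.
  by apply: lebesgue_measure_hull3_lt => //; rewrite revE swapE opprK.
- by move: D0; rewrite /cross3 QS PS !subrr !mulr0 subrr eqxx.
Qed.

(** * From the indexed vertices to the area formula *)

Lemma triangle_region_hull3 {R : realType} (V : 'I_3 -> plane R) :
  triangle_region V = hull3 (V 0) (V 1) (V 2%:R).
Proof.
have E (f : 'I_3 -> R) : \sum_(i < 3) f i = f 0 + f 1 + f 2%:R.
  rewrite !big_ord_recr big_ord0 /= add0r.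
  by congr (f _ + f _ + f _); apply: val_inj.
have E2 (f : 'I_3 -> plane R) : \sum_(i < 3) f i = f 0 + f 1 + f 2%:R.
  rewrite !big_ord_recr big_ord0 /= add0r.
  by congr (f _ + f _ + f _); apply: val_inj.
apply/seteqP; split=> X /=.
  move=> [w [w0 w1 ->]]; exists (w 0, w 1, w 2%:R) => /=.
  by rewrite E in w1; rewrite E2.
move=> [[[a b] c] /= [[a0 b0 c0] abc X1 X2]].
exists (fun i => nth 0 [:: a; b; c] i); split.
- by move=> [[|[|[|]]]].
- by rewrite E.
- by rewrite E2 /=; case: X X1 X2 => x y /= -> ->.
Qed.

Lemma ord3_ind (P : 'I_3 -> Prop) : P 0 -> P 1 -> P 2%:R -> forall i, P i.
Proof.
move=> p0 p1 p2 [[|[|[|//]]] i3].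
- by rewrite (_ : Ordinal i3 = 0)//; apply: val_inj.
- by rewrite (_ : Ordinal i3 = 1)//; apply: val_inj.
- by rewrite (_ : Ordinal i3 = 2%:R)//; apply: val_inj.
Qed.

Lemma is_triangle_cross3_neq0 {R : realType} (V : 'I_3 -> plane R) :
  is_triangle V -> cross3 (V 0) (V 1) (V 2%:R) != 0.
Proof.
move=> hV; apply/negP => /eqP D0; apply: hV.
have [V02|V02] := eqVneq (V 2%:R) (V 0).
  have [V01|V01] := eqVneq (V 1) (V 0).
    exists (V 0), (1, 1); split; first by rewrite xpair_eqE oner_eq0.
    by apply: ord3_ind; exists 0; rewrite scale0r addr0.
  exists (V 0), (V 1 - V 0); split; first by rewrite subr_eq0.
  apply: ord3_ind; [exists 0|exists 1|exists 0];
    by rewrite ?scale0r ?addr0// scale1r subrKC.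
exists (V 0), (V 2%:R - V 0); split; first by rewrite subr_eq0.
apply: ord3_ind; [exists 0| |exists 1]; rewrite ?scale0r ?addr0// ?scale1r ?subrKC//.
(* The parameter of [V 1] is read off a coordinate in which [V 0] and [V 2%:R] differ; [D0] gives
   the other coordinate. *)
move: V02 D0; case: (V 0) (V 1) (V 2%:R) => [x0 y0] [x1 y1] [x2 y2].
rewrite /cross3 /= xpair_eqE negb_and => /orP[] n0 D0.
- have n : x2 - x0 != 0 by rewrite subr_eq0.
  exists ((x1 - x0) / (x2 - x0)); congr pair => /=; rewrite /GRing.scale /=.
    by field.
  apply: (mulfI n); rewrite mulrDr.
  rewrite (_ : _ * (_ / _ * _) = (x1 - x0) * (y2 - y0)); last by field.
  lra.
- have n : y2 - y0 != 0 by rewrite subr_eq0.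
  exists ((y1 - y0) / (y2 - y0)); congr pair => /=; rewrite /GRing.scale /=.
    apply: (mulfI n); rewrite mulrDr.
    rewrite (_ : _ * (_ / _ * _) = (y1 - y0) * (x2 - x0)); last by field.
    lra.
  by field.
Qed.

Lemma area_is_triangle {R : realType} (V : 'I_3 -> plane R) :
  is_triangle V -> area V = `|cross3 (V 0) (V 1) (V 2%:R)| / 2.
Proof.
move=> hV; rewrite /area triangle_region_hull3 lebesgue_measure_hull3//.
exact: is_triangle_cross3_neq0.
Qed.

(** * The median identity *)

Lemma sqr_dist {R : realType} (P Q : plane R) :
  dist P Q ^+ 2 = (P.1 - Q.1) ^+ 2 + (P.2 - Q.2) ^+ 2.
Proof. by rewrite sqr_sqrtr// addr_ge0// sqr_ge0. Qed.

Theorem mainTheorem2 (R : realType) (V : 'I_3 -> plane R)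
    (hV : is_triangle V) (s : 'S_3) :
  let a := side_length V (s 0) in
  let b := side_length V (s 1) in
  let c := side_length V (s 2%:R) in
  let mc := median_length V (s 2%:R) in
  ((a / 2) ^+ 2 - (b / 2) ^+ 2) ^+ 2 + area V ^+ 2 = (c / 2 * mc) ^+ 2.
Proof.
move=> a b c mc; rewrite area_is_triangle//.
have add3 (i j k : 'I_3) : (i + j)%N = k %[mod 3] -> V (i + j)%R = V k.
  by move=> ijk; congr V; apply: val_inj; rewrite /= ijk modn_small.
(* Every length and the absolute value now occur squared, so [sqr_dist] can remove all square
   roots. *)
rewrite !expr_div_n real_normK ?num_real// [(c / 2 * mc) ^+ 2]exprMn expr_div_n.
(* Injectivity of [s] leaves 6 of the 27 index triples, each a polynomial identity in the
   coordinates. *)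
have : [/\ s 0 != s 1, s 1 != s 2%:R & s 2%:R != s 0].
  by rewrite !(inj_eq perm_inj).
rewrite /a /b /c /mc; move: (s 0) (s 1) (s 2%:R).
apply: ord3_ind; apply: ord3_ind; apply: ord3_ind => -[] // _ _ _;
  rewrite /side_length /median_length !sqr_dist.
all: rewrite ?(add3 0 1 1)// ?(add3 0 2%:R 2%:R)// ?(add3 1 1 2%:R)//
  ?(add3 1 2%:R 0)// ?(add3 2%:R 1 0)// ?(add3 2%:R 2%:R 1)//.
all: by rewrite /midpoint /cross3 /= /GRing.scale /=; field.
Qed.
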